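(* Let $A\in\mathbb{R}^{m\times n}$ have columns $a_{.1},\dots,a_{.n}$, let $b\in\mathbb{R}^m$, $c\in\mathbb{R}^n$, and let $\hat{x}\in\mathbb{R}^n$ be a mixed integer feasible solution, i.e. $A\hat{x}=b$, $\hat{x}\ge 0$, and $\hat{x}_j\in\mathbb{Z}$ for $j=q+1,\dots,n$. Let $\mathcal{I}=\{i\in\{1,\dots,n\}:\hat{x}_i>0\}$ and $\bar{\mathcal{I}}=\{i\in\{1,\dots,n\}:\hat{x}_i=0\}$. Suppose $\delta^*\in\mathbb{R}^n$, $y^*\in\mathbb{R}^m$, $s^*=(s^*_i)_{i\in\bar{\mathcal{I}}}$ and $\varepsilon^*=(\varepsilon^*_i)_{i\in\mathcal{I}}$ satisfy $$\begin{aligned} & a_{.i}^\top y^*+\frac{\varepsilon^*_i}{\hat{x}_i}=c_i,\quad \varepsilon^*_i\ge 0, && i\in\mathcal{I},\\ & a_{.i}^\top y^*+s^*_i=c_i,\quad s^*_i\ge 0, && i\in\bar{\mathcal{I}},\\ & A\delta^*=0, &&\\ & \delta^*_i\le \hat{x}_i, && i=1,\dots,n,\\ & \delta^*_i s^*_i=0, && i\in\bar{\mathcal{I}},\\ & \varepsilon^*_i(\hat{x}_i-\delta^*_i)=0, && i\in\mathcal{I}. \end{aligned}$$ Define $x^{LP}=\hat{x}-\delta^*$, $y^{LP}=y^*$, $s^{LP}_i=\varepsilon^*_i/\hat{x}_i$ for $i\in\mathcal{I}$, and $s^{LP}_i=s^*_i$ for $i\in\bar{\mathcal{I}}$. Then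 $x^{LP}$ is an optimal solution of the linear programming relaxation $\min\{c^\top x: Ax=b,\ x\ge 0\}$, and $(y^{LP},s^{LP})$ is an optimal solution of its dual $\max\{b^\top y: A^\top y+s=c,\ s\ge 0\}$.
   Context: Here $q\in\{0,\dots,n\}$ is fixed; the forward mixed integer problem is $\min\{c^\top x: Ax=b,\ x\ge 0,\ x_j \text{ integer for } j=q+1,\dots,n\}$. Its linear programming relaxation $\min\{c^\top x:Ax=b,\ x\ge 0\}$ is assumed feasible with a finite optimal solution. *)

(* Defs.v *)
From HB Require Import structures.
From mathcomp Require Import all_boot all_order all_algebra.
From mathcomp Require Import reals.

Set Implicit Arguments.
Unset Strict Implicit.
Unset Printing Implicit Defensive.

Import Order.TTheory GRing.Theory Num.Theory.
Local Open Scope ring_scope.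

Definition dotv (R : realType) (k : nat) (u v : 'cV[R]_k) : R :=
  (u^T *m v) 0 0.

Definition lp_feasible (R : realType) (m n : nat) (A : 'M[R]_(m, n))
    (b : 'cV[R]_m) (x : 'cV[R]_n) : Prop :=
  A *m x = b /\ (forall j, 0 <= x j 0).

Definition lp_optimal (R : realType) (m n : nat) (A : 'M[R]_(m, n))
    (b : 'cV[R]_m) (c x : 'cV[R]_n) : Prop :=
  lp_feasible A b x /\
  (forall z, lp_feasible A b z -> dotv c x <= dotv c z).

(* Ordinals are 0-based, so the integer coordinates j = q+1, ..., n are those
   with q <= j here. *)
Definition mip_feasible (R : realType) (m n : nat) (q : nat)
    (A : 'M[R]_(m, n)) (b : 'cV[R]_m) (x : 'cV[R]_n) : Prop :=
  lp_feasible A b x /\ (forall j : 'I_n, (q <= j)%N -> x j 0 \is a Num.int).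

Definition dual_feasible (R : realType) (m n : nat) (A : 'M[R]_(m, n))
    (c : 'cV[R]_n) (y : 'cV[R]_m) (s : 'cV[R]_n) : Prop :=
  A^T *m y + s = c /\ (forall j, 0 <= s j 0).

Definition dual_optimal (R : realType) (m n : nat) (A : 'M[R]_(m, n))
    (b : 'cV[R]_m) (c : 'cV[R]_n) (y : 'cV[R]_m) (s : 'cV[R]_n) : Prop :=
  dual_feasible A c y s /\
  (forall y' s', dual_feasible A c y' s' -> dotv b y' <= dotv b y).

Definition pos_set (R : realType) (n : nat) (x : 'cV[R]_n) : {set 'I_n} :=
  [set i | 0 < x i 0].

Definition zero_set (R : realType) (n : nat) (x : 'cV[R]_n) : {set 'I_n} :=
  [set i | x i 0 == 0].

(* The families eps = (eps_i), i in pos_set x, and s = (s_i), i in zero_set x,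
   are total functions read only on their index sets. When x >= 0 the two sets
   partition 'I_n, so the else branch is exactly i in zero_set x. *)
Definition slackLP (R : realType) (n : nat) (x : 'cV[R]_n)
    (eps s : 'I_n -> R) : 'cV[R]_n :=
  \col_i (if i \in pos_set x then eps i / x i 0 else s i).

(* Main.v *)
Require Import Defs.
From HB Require Import structures.
From mathcomp Require Import all_boot all_order all_algebra.
From mathcomp Require Import reals.

Set Implicit Arguments.
Unset Strict Implicit.
Unset Printing Implicit Defensive.

Import Order.TTheory GRing.Theory Num.Theory.
Local Open Scope ring_scope.

(** Eliminating [b] and [c] through the two equality systems
    turns the duality gap of a feasible pair into
      [c^T x - b^T y = (A^T y + s)^T x - (A x)^T y = s^T x],
    which is nonnegative when [x] and [s] are ([duality_gap]).  A pair with
    [s^T x = 0] therefore attains equality in weak duality, so both of its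
    members are optimal ([complementary_slackness_optimal]).

    It remains to see that the point [xhat - delta] and the slack read off
    from [s] and [eps] form such a pair.  Moving along [- delta], in the
    kernel of [A], preserves [A x = b], and [delta <= xhat] keeps the point
    nonnegative.  Writing the multiplier of a positive coordinate as
    [eps_i / xhat_i] makes it a nonnegative reduced cost.  The two
    complementarity hypotheses then make each product
    [s_i * x_i] vanish: where [xhat_i = 0] the new coordinate is [- delta_i],
    and where [xhat_i > 0] the division by [xhat_i] is harmless. *)

Lemma dotvE (R : realType) (k : nat) (u v : 'cV[R]_k) :
  dotv u v = \sum_i u i 0 * v i 0.
Proof. by rewrite /dotv mxE; apply: eq_bigr => i _; rewrite mxE. Qed.

Lemma dotv_ge0 (R : realType) (k : nat) (u v : 'cV[R]_k) :
  (forall i, 0 <= u i 0) -> (forall i, 0 <= v i 0) -> 0 <= dotv u v.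
Proof.
by move=> u_ge0 v_ge0; rewrite dotvE sumr_ge0 // => i _; rewrite mulr_ge0.
Qed.

(** An exact form of weak duality: it yields the inequality once signs are
    known, and the equality of the two objectives at a complementary pair. *)
Lemma duality_gap (R : realType) (m n : nat) (A : 'M[R]_(m, n))
    (b : 'cV[R]_m) (c x : 'cV[R]_n) (y : 'cV[R]_m) (s : 'cV[R]_n) :
  A *m x = b -> A^T *m y + s = c -> dotv c x = dotv b y + dotv s x.
Proof.
move=> <- <-; rewrite /dotv linearD /= mulmxDl mxE; congr (_ + _).
(* Both terms are the scalar [y^T A x]; a 1 x 1 matrix equals its transpose. *)
by rewrite -[(A *m x)^T *m y]trmxK [RHS]mxE !trmx_mul !trmxK mulmxA.
Qed.

Lemma weak_duality (R : realType) (m n : nat) (A : 'M[R]_(m, n))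
    (b : 'cV[R]_m) (c x : 'cV[R]_n) (y : 'cV[R]_m) (s : 'cV[R]_n) :
  lp_feasible A b x -> dual_feasible A c y s -> dotv b y <= dotv c x.
Proof.
move=> [Ax x_ge0] [Ay s_ge0].
by rewrite (duality_gap Ax Ay) lerDl dotv_ge0.
Qed.

(** With a zero gap, the common objective value is by weak duality a lower
    bound for the primal and an upper bound for the dual. *)
Lemma complementary_slackness_optimal (R : realType) (m n : nat)
    (A : 'M[R]_(m, n)) (b : 'cV[R]_m) (c x : 'cV[R]_n) (y : 'cV[R]_m)
    (s : 'cV[R]_n) :
  lp_feasible A b x -> dual_feasible A c y s ->
  (forall i, s i 0 * x i 0 = 0) ->
  lp_optimal A b c x /\ dual_optimal A b c y s.
Proof.
move=> xF ysF sx0.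
have cx_by : dotv c x = dotv b y.
  by rewrite (duality_gap xF.1 ysF.1) [dotv s x]dotvE big1 ?addr0.
split; split=> //.
- by move=> z zF; rewrite cx_by (weak_duality zF ysF).
- by move=> y' s' ysF'; rewrite -cx_by (weak_duality xF ysF').
Qed.

Lemma pos_or_zero_set (R : realType) (n : nat) (x : 'cV[R]_n) (i : 'I_n) :
  0 <= x i 0 -> (i \notin pos_set x) = (i \in zero_set x).
Proof. by move=> x_ge0; rewrite !inE lt0r x_ge0 andbT negbK. Qed.

Theorem theorem2 (R : realType) (m n q : nat) (hq : (q <= n)%N)
    (A : 'M[R]_(m, n)) (b : 'cV[R]_m) (c : 'cV[R]_n)
    (hLP : exists x0 : 'cV[R]_n, lp_optimal A b c x0)
    (xhat : 'cV[R]_n) (hxhat : mip_feasible q A b xhat)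
    (delta : 'cV[R]_n) (y : 'cV[R]_m) (s eps : 'I_n -> R)
    (hI : forall i, i \in pos_set xhat ->
       dotv (col i A) y + eps i / xhat i 0 = c i 0 /\ 0 <= eps i)
    (hIbar : forall i, i \in zero_set xhat ->
       dotv (col i A) y + s i = c i 0 /\ 0 <= s i)
    (hAdelta : A *m delta = 0)
    (hdelta : forall i, delta i 0 <= xhat i 0)
    (hcs : forall i, i \in zero_set xhat -> delta i 0 * s i = 0)
    (hce : forall i, i \in pos_set xhat ->
       eps i * (xhat i 0 - delta i 0) = 0) :
  lp_optimal A b c (xhat - delta) /\
  dual_optimal A b c y (slackLP xhat eps s).
Proof.
have [[Axhat xhat_ge0] _] := hxhat.
apply: complementary_slackness_optimal.
- split; first by rewrite mulmxBr hAdelta subr0.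
  by move=> j; rewrite !mxE subr_ge0.
- have row_dot i : (A^T *m y) i 0 = dotv (col i A) y.
    by rewrite dotvE mxE; apply: eq_bigr => k _; rewrite !mxE.
  split.
    apply/matrixP => i j; rewrite ord1 mxE row_dot mxE.
    case: ifPn => [/hI[] //|].
    by rewrite pos_or_zero_set // => /hIbar[].
  move=> i; rewrite mxE; case: ifPn => [/hI[_ eps_ge0]|].
    by rewrite divr_ge0.
  by rewrite pos_or_zero_set // => /hIbar[].
- move=> i; rewrite !mxE; case: ifPn => [iI|].
    by rewrite mulrAC hce // mul0r.
  rewrite pos_or_zero_set // => iZ.
  have /eqP -> : xhat i 0 == 0 by move: iZ; rewrite inE.
  by rewrite sub0r mulrN mulrC hcs // oppr0.
Qed.
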